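(* Let $G$ be a graph. The symset chromatic spectrum of $G$ is the interval of integers $\Sigma_{\chi_{sym}} (G) = \{2, \dots,\chi (G)\}$.
   Context: Graphs are finite multigraphs without loops (parallel edges allowed); $\chi(G)$ is the ordinary chromatic number. A signed graph $(G,\sigma)$ is a graph $G$ with a signature $\sigma:E(G)\to\{+,-\}$. A symmetric set is a set $S$ with an involution $s\mapsto -s$ on $S$; $s$ is self-inverse if $s=-s$. $S_{2k}^t$ ($t,k\ge 0$) is the symmetric set with exactly $t$ self-inverse elements $0_1,\dots,0_t$ and $2k$ non-self-inverse elements $\pm s_1,\dots,\pm s_k$. A proper $S_{2k}^t$-coloring of $(G,\sigma)$ is a map $c:V(G)\to S_{2k}^t$ with $c(v)\ne\sigma(e)c(w)$ for every edge $e=vw$. For $t\in\{0,\dots,\chi(G)\}$, $\chi_{sym}^t(G,\sigma)$ is the minimum of $t+2k$ over all $k\ge0$ for which $(G,\sigma)$ has a proper $S_{2k}^t$-coloring. The symset chromatic number $\chi_{sym}(G,\sigma)$ is $\min\{\chi_{sym}^t(G,\sigma): 0\le t\le\chi(G)\}$, where it is regarded as attained with the largest possible $t$ (this choice of $t$ does not affect the value). The symset chromatic spectrum of $G$ is $\Sigma_{\chi_{sym}}(G)=\{\chi_{sym}(G,\sigma):\sigma\text{ a signature of }G\}$.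
   Formalization: The graph G is assumed to have chromatic number at least 2 (i.e. at least one edge); for an edgeless graph with a vertex the spectrum is {1}, and for the graph without vertices it is {0}, while {2,…,χ(G)} is empty. *)

(* Defs.v *)
From mathcomp Require Import all_boot.

Set Implicit Arguments.
Unset Strict Implicit.
Unset Printing Implicit Defensive.

(* Parallel edges are edges with the same pair of ends; requiring two distinct
   ends excludes loops. *)
Record multigraph := Multigraph {
  vertex : finType;
  edge : finType;
  ends : edge -> {set vertex};
  card_ends : forall e, #|ends e| = 2
}.

(* [true] is the sign -, [false] the sign +. *)
Definition signature (G : multigraph) := {ffun edge G -> bool}.

Record symset := Symset {
  symset_sort :> finType;
  symopp : symset_sort -> symset_sort;
  symoppK : involutive symopp
}.

Definition sign_act (S : symset) (neg : bool) (s : S) : S :=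
  if neg then symopp s else s.

Definition self_inverse (S : symset) : {set S} := [set s : S | s == symopp s].

(* The symmetric set S_{2k}^t: [inl i] is the self-inverse element 0_i, and
   [inr (j, b)] is s_j for b = false and -s_j for b = true. *)
Definition std_opp (t k : nat) (s : 'I_t + 'I_k * bool) : 'I_t + 'I_k * bool :=
  match s with
  | inl i => inl i
  | inr (j, b) => inr (j, ~~ b)
  end.

Lemma std_oppK (t k : nat) : involutive (@std_opp t k).
Proof. by case=> [i | [j b]] //=; rewrite negbK. Qed.

Definition std_symset (t k : nat) : symset := Symset (@std_oppK t k).

Lemma card_std_symset (t k : nat) : #|std_symset t k| = t + 2 * k.
Proof. by rewrite card_sum card_prod card_bool !card_ord mulnC. Qed.

Lemma card_self_inverse (t k : nat) : #|self_inverse (std_symset t k)| = t.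
Proof.
have -> : self_inverse (std_symset t k) = inl @: [set: 'I_t].
  apply/setP=> s; rewrite inE; case: s => [i | [j b]] /=.
    by rewrite eqxx imset_f.
  have -> : (inr (j, b) == inr (j, ~~ b) :> 'I_t + 'I_k * bool) = false.
    by case: b; apply/eqP=> -[].
  by apply/esym/imsetP=> -[].
by rewrite card_imset ?cardsT ?card_ord // => i j [].
Qed.

Definition proper_coloring (G : multigraph) (C : finType)
    (c : {ffun vertex G -> C}) : bool :=
  [forall e : edge G, forall v : vertex G, forall w : vertex G,
     (ends e == [set v; w]) ==> (c v != c w)].

Definition colorable (G : multigraph) (n : nat) : bool :=
  [exists c : {ffun vertex G -> 'I_n}, proper_coloring c].

Definition proper_sym_coloring (G : multigraph) (sigma : signature G)
    (S : symset) (c : {ffun vertex G -> S}) : bool :=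
  [forall e : edge G, forall v : vertex G, forall w : vertex G,
     (ends e == [set v; w]) ==> (c v != sign_act (sigma e) (c w))].

Definition sym_colorable (G : multigraph) (sigma : signature G)
    (S : symset) : bool :=
  [exists c : {ffun vertex G -> S}, proper_sym_coloring sigma c].

Lemma ends_neq (G : multigraph) (e : edge G) (v w : vertex G) :
  ends e = [set v; w] -> v != w.
Proof. by move=> evw; have := card_ends e; rewrite evw cards2; case: eqP. Qed.

Lemma colorable_ex (G : multigraph) : exists n, colorable G n.
Proof.
exists #|vertex G|; apply/existsP; exists [ffun v => enum_rank v].
apply/forallP=> e; apply/forallP=> v; apply/forallP=> w.
apply/implyP=> /eqP /ends_neq; rewrite !ffunE.
by apply: contra => /eqP /enum_rank_inj ->.
Qed.

Definition chromatic_number (G : multigraph) : nat := ex_minn (colorable_ex G).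

(* m = t + 2k for some k such that (G, sigma) has a proper S_{2k}^t-coloring;
   m = t + 2k forces k <= m, so bounding k loses nothing. *)
Definition sym_size (G : multigraph) (sigma : signature G) (t m : nat) : bool :=
  [exists k : 'I_m.+1,
     (m == t + 2 * k) && sym_colorable sigma (std_symset t k)].

Lemma sym_size_ex (G : multigraph) (sigma : signature G) (t : nat) :
  exists m, sym_size sigma t m.
Proof.
set k := #|vertex G|; have kP : k < (t + 2 * k).+1.
  by rewrite ltnS mulSn mul1n addnA leq_addl.
exists (t + 2 * k); apply/existsP; exists (Ordinal kP).
rewrite /= eqxx /=; apply/existsP.
exists [ffun v => inr (enum_rank v, false) : std_symset t k].
apply/forallP=> e; apply/forallP=> v; apply/forallP=> w.
apply/implyP=> /eqP /ends_neq; rewrite !ffunE; apply: contra.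
by case: (sigma e) => /eqP [] // /enum_rank_inj ->.
Qed.

Definition chi_sym_at (G : multigraph) (sigma : signature G) (t : nat) : nat :=
  ex_minn (sym_size_ex sigma t).

Lemma chi_sym_ex (G : multigraph) (sigma : signature G) :
  exists m, [exists t : 'I_(chromatic_number G).+1, chi_sym_at sigma t == m].
Proof. by exists (chi_sym_at sigma 0); apply/existsP; exists ord0. Qed.

Definition chi_sym (G : multigraph) (sigma : signature G) : nat :=
  ex_minn (chi_sym_ex sigma).

Definition symset_spectrum (G : multigraph) : pred nat :=
  [pred n | [exists sigma : signature G, chi_sym sigma == n]].

(* Main.v *)
Require Import Defs.
From mathcomp Require Import all_boot.

(** Fix a proper coloring with chi(G) colors, n of which are identified with
    the elements of S_2^(n-2), and recolor every vertex bearing one of the other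
    chi(G) - n colors with s_1. Let the negative edges be those with both ends
    now colored s_1: the result is a proper S_2^(n-2)-coloring. All edges
    between the vertices that kept their color are positive, so any proper
    symset coloring is an ordinary one on them; together with the chi(G) - n
    remaining colors it must use at least chi(G) colors, hence the symmetric
    set has at least n elements. *)

Lemma proper_coloringP (G : multigraph) (C : finType)
    (c : {ffun vertex G -> C}) :
  reflect (forall e v w, ends e = [set v; w] -> c v != c w)
          (proper_coloring c).
Proof.
apply: (iffP forallP) => [cP e v w /eqP evw | cP e].
  by have /forallP/(_ v)/forallP/(_ w)/implyP/(_ evw) := cP e.
by apply/forallP=> v; apply/forallP=> w; apply/implyP=> /eqP; apply: cP.
Qed.

Lemma proper_sym_coloringP (G : multigraph) (sigma : signature G) (S : symset)
    (c : {ffun vertex G -> S}) :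
  reflect (forall e v w, ends e = [set v; w] ->
             c v != sign_act (sigma e) (c w))
          (proper_sym_coloring sigma c).
Proof.
apply: (iffP forallP) => [cP e v w /eqP evw | cP e].
  by have /forallP/(_ v)/forallP/(_ w)/implyP/(_ evw) := cP e.
by apply/forallP=> v; apply/forallP=> w; apply/implyP=> /eqP; apply: cP.
Qed.

Lemma proper_coloring_comp (G : multigraph) (C D : finType) (f : C -> D)
    (c : {ffun vertex G -> C}) :
  injective f -> proper_coloring c -> proper_coloring [ffun v => f (c v)].
Proof.
move=> f_inj /proper_coloringP cP; apply/proper_coloringP=> e v w evw.
by rewrite !ffunE (inj_eq f_inj) (cP e).
Qed.

Lemma chromatic_number_le (G : multigraph) (C : finType)
    (c : {ffun vertex G -> C}) :
  proper_coloring c -> chromatic_number G <= #|C|.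
Proof.
move=> cP; rewrite /chromatic_number; case: ex_minnP => m _; apply.
apply/existsP; exists [ffun v => enum_rank (c v)].
exact/proper_coloring_comp/cP/enum_rank_inj.
Qed.

(** Transport along a bijection lets optimal colors be taken in a symmetric set or a sum type. *)
Lemma chromatic_number_coloring (G : multigraph) (C : finType) :
  #|C| = chromatic_number G ->
  exists c : {ffun vertex G -> C}, proper_coloring c.
Proof.
rewrite /chromatic_number; case: ex_minnP => m /existsP[c cP] _ Cm.
exists [ffun v => enum_val (cast_ord (esym Cm) (c v))].
apply: (@proper_coloring_comp _ _ _ (fun i => enum_val (cast_ord _ i))) => //.
exact: inj_comp enum_val_inj (@cast_ord_inj _ _ _).
Qed.

Lemma chi_sym_le (G : multigraph) (sigma : signature G) (t k : nat) :
  t <= chromatic_number G -> sym_colorable sigma (std_symset t k) ->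
  chi_sym sigma <= t + 2 * k.
Proof.
move=> t_le colP; apply: (@leq_trans (chi_sym_at sigma t)).
  rewrite /chi_sym; case: ex_minnP => m _; apply.
  by apply/existsP; exists (Ordinal (t_le : t < _.+1)).
rewrite /chi_sym_at; case: ex_minnP => m _; apply.
have k_lt : k < (t + 2 * k).+1 by rewrite ltnS mulSn mul1n addnA leq_addl.
by apply/existsP; exists (Ordinal k_lt); rewrite eqxx.
Qed.

Lemma chi_sym_attained (G : multigraph) (sigma : signature G) :
  exists t k, chi_sym sigma = t + 2 * k /\
    sym_colorable sigma (std_symset t k).
Proof.
rewrite /chi_sym; case: ex_minnP => m /existsP[t /eqP <-] _.
rewrite /chi_sym_at; case: ex_minnP => p /existsP[k /andP[/eqP pE colP]] _.
by exists t, k.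
Qed.

(** For k = 0 all elements are self-inverse, so signs act trivially and symset colorings become
    ordinary ones. *)
Lemma sign_act_std0 (t : nat) (b : bool) (s : std_symset t 0) :
  sign_act b s = s.
Proof. by case: b s => [] [i | [[]]]. Qed.

Lemma sym_colorable0 (G : multigraph) (sigma : signature G) (t : nat) :
  sym_colorable sigma (std_symset t 0) =
  [exists c : {ffun vertex G -> std_symset t 0}, proper_coloring c].
Proof.
apply: eq_existsb => c.
by apply/proper_sym_coloringP/proper_coloringP=> cP e v w /cP;
  rewrite sign_act_std0.
Qed.

Lemma chi_sym_le_chromatic (G : multigraph) (sigma : signature G) :
  chi_sym sigma <= chromatic_number G.
Proof.
rewrite -[leqRHS]addn0 -(muln0 2); apply: chi_sym_le => //.
rewrite sym_colorable0; apply/existsP; apply: chromatic_number_coloring.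
by rewrite card_std_symset addn0.
Qed.

(** One pair of non-self-inverse elements already counts 2; for k = 0 the coloring is ordinary, so t
    is at least chi(G). *)
Lemma chi_sym_ge2 (G : multigraph) (sigma : signature G) :
  2 <= chromatic_number G -> 2 <= chi_sym sigma.
Proof.
have [t [[|k] [-> colP]]] := chi_sym_attained G sigma => [chi_ge2|_]; last first.
  by rewrite mulnS addnCA leq_addr.
move: colP; rewrite sym_colorable0 => /existsP[c /chromatic_number_le].
by rewrite card_std_symset; apply: leq_trans.
Qed.

Definition merge {t r : nat} (x : std_symset t 1 + 'I_r) : std_symset t 1 :=
  if x is inl s then s else inr (ord0, false).

(** Quantifying over the set [ends e] avoids ordering the two ends. *)
Definition merge_signature {G : multigraph} {t r : nat}
    (c : {ffun vertex G -> std_symset t 1 + 'I_r}) : signature G :=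
  [ffun e => [forall v in ends e, merge (c v) == inr (ord0, false)]].

Lemma merge_signatureE (G : multigraph) (t r : nat)
    (c : {ffun vertex G -> std_symset t 1 + 'I_r}) e v w :
  ends e = [set v; w] ->
  merge_signature c e =
    (merge (c v) == inr (ord0, false)) && (merge (c w) == inr (ord0, false)).
Proof.
move=> evw; rewrite ffunE evw; apply/forall_inP/andP=> [all1 | [v1 w1] x].
  by split; apply: all1; rewrite !inE eqxx ?orbT.
by rewrite !inE => /orP[] /eqP ->.
Qed.

(** On a negative edge both ends carry s_1, which differs from -s_1. On a positive edge they do not
    both carry s_1, so equal merged colors could only come from equal colors under [c]. *)
Lemma merge_sym_colorable (G : multigraph) (t r : nat)
    (c : {ffun vertex G -> std_symset t 1 + 'I_r}) :
  proper_coloring c -> sym_colorable (merge_signature c) (std_symset t 1).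
Proof.
move=> /proper_coloringP cP; apply/existsP; exists [ffun v => merge (c v)].
apply/proper_sym_coloringP=> e v w evw.
rewrite (merge_signatureE _ _ _ _ _ _ _ evw) !ffunE.
have [/andP[/eqP -> /eqP ->] // | ] := boolP (_ && _).
have := cP e v w evw.
by case: (c v) (c w) => [x|i] [y|j] //= _; rewrite ?eqxx ?andbT // eq_sym.
Qed.

Lemma chromatic_number_le_merge (G : multigraph) (t r : nat)
    (c : {ffun vertex G -> std_symset t 1 + 'I_r}) (S : symset) :
  proper_coloring c -> sym_colorable (merge_signature c) S ->
  chromatic_number G <= #|S| + r.
Proof.
move=> /proper_coloringP cP /existsP[d /proper_sym_coloringP dP].
(* Merged vertices get back their old colors, which are disjoint from the values of [d] used
   elsewhere. *)
pose f : {ffun vertex G -> S + 'I_r} :=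
  [ffun v => if c v is inr i then inr i else inl (d v)].
suff /chromatic_number_le : proper_coloring f by rewrite card_sum card_ord.
apply/proper_coloringP=> e v w evw; rewrite !ffunE.
have := dP e v w evw; rewrite (merge_signatureE _ _ _ _ _ _ _ evw).
have := cP e v w evw.
case: (c v) (c w) => [x|i] [y|j] //= xy.
(* Both ends kept their color: a negative edge would make both s_1 under [c], against properness. *)
case: andP => [[/eqP xE /eqP yE] | _] //.
by rewrite xE yE eqxx in xy.
Qed.

(** The merged coloring gives the upper bound; cancelling r in chi(G) = t + 2 + r <= t' + 2k + r
    gives the lower one. *)
Lemma chi_sym_merge_signature (G : multigraph) (t r : nat)
    (c : {ffun vertex G -> std_symset t 1 + 'I_r}) :
  t + 2 + r = chromatic_number G -> proper_coloring c ->
  chi_sym (merge_signature c) = t + 2.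
Proof.
move=> chiE cP; apply/eqP; rewrite eqn_leq; apply/andP; split.
  apply: (chi_sym_le _ _ t 1); last exact: merge_sym_colorable.
  by rewrite -chiE -addnA leq_addr.
have [t' [k [-> colP]]] := chi_sym_attained G (merge_signature c).
have := chromatic_number_le_merge _ _ _ _ _ cP colP.
by rewrite card_std_symset -chiE leq_add2r.
Qed.

Theorem theorem3p2 (G : multigraph) (chi_ge2 : 2 <= chromatic_number G) :
  symset_spectrum G =i [pred n | 2 <= n <= chromatic_number G].
Proof.
move=> n; rewrite !inE; apply/existsP/idP => [[sigma /eqP <-] | /andP[n2 n_le]].
  by rewrite chi_sym_ge2 ?chi_sym_le_chromatic.
(* The summands count the self-inverse colors, the pair s_1, -s_1, and the colors to be merged. *)
have chiE : n - 2 + 2 + (chromatic_number G - n) = chromatic_number G.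
  by rewrite subnK // subnKC.
have [|c cP] := @chromatic_number_coloring G
    (std_symset (n - 2) 1 + 'I_(chromatic_number G - n))%type.
  by rewrite card_sum card_std_symset card_ord.
exists (merge_signature c).
by rewrite (chi_sym_merge_signature _ _ _ _ chiE cP) subnK.
Qed.
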